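(* Let $m$ be a positive integer and let $\mathcal{C}\le\mathcal{L}_{m,2}[x]$ be an $\mathbb{F}_{2^m}$-linear MRD code of dimension $k\geq 1$ over $\mathbb{F}_{2^m}$, where $k=2$ or $k=m-2$. Then there exists a positive integer $s$ with $\gcd(s,m)=1$ such that $\mathcal{C}$ is linearly equivalent to the generalized Gabidulin code $\mathcal{G}_{k,s,m}$ (with $q=2$).
   Context: For a prime power $q$ and $m\ge 1$, $\mathcal{L}_{m,q}[x]$ is the set of linearized polynomials $f=\sum_{i=0}^{m-1} f_i x^{q^i}$ with $f_i\in\mathbb{F}_{q^m}$ (i.e. $q$-polynomials modulo $x^{q^m}-x$), with addition and composition modulo $x^{q^m}-x$; it is an $\mathbb{F}_{q^m}$-vector space of dimension $m$ under left multiplication by scalars, and is identified with $\mathrm{End}_{\mathbb{F}_q}(\mathbb{F}_{q^m})$ via evaluation. The rank of $f$ is $\mathrm{rk}(f)=\dim_{\mathbb{F}_q}(\mathrm{Im} f)$. An $\mathbb{F}_{q^m}$-linear rank-metric code in $\mathcal{L}_{m,q}[x]$ is a nonzero $\mathbb{F}_{q^m}$-linear subspace $\mathcal{C}$; its dimension is its $\mathbb{F}_{q^m}$-dimension. A code of dimension $k$ is MRD (maximum rank distance) if the minimum rank of its nonzero elements equals $m-k+1$. Two codes $\mathcal{C}_1,\mathcal{C}_2\le\mathcal{L}_{m,q}[x]$ are linearly equivalent if there is an invertible $q$-polynomial $g\in\mathcal{L}_{m,q}[x]$ with $\mathcal{C}_1=\mathcal{C}_2\circ g=\{f\circ g: f\in\mathcal{C}_2\}$.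 For positive integers $k\le m$ and $s$ with $\gcd(s,m)=1$, the generalized Gabidulin code is $\mathcal{G}_{k,s,m}=\langle x,x^{q^s},\ldots,x^{q^{s(k-1)}}\rangle_{\mathbb{F}_{q^m}}$, with exponents understood modulo $x^{q^m}-x$. *)

(* Defs.v *)
From HB Require Import structures.
From mathcomp Require Import all_boot all_order all_algebra all_field.

Set Implicit Arguments.
Unset Strict Implicit.
Unset Printing Implicit Defensive.

Import GRing.Theory.
Local Open Scope ring_scope.

(* Throughout, F is the finite field with q = #|F| elements and L is an
   extension of F, of degree m (so L is the field with q ^ m elements).
   The degree m is a parameter of the definitions below; that
   \dim {:L} = m is a hypothesis of the statements using them. *)

Definition lmod (F : finFieldType) (L : fieldExtType F) (m : nat) : {poly L} :=
  'X^(#|F| ^ m) - 'X.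

(* Polynomials modulo x^(q^m) - x, represented by their remainders; by lmodE
   below, the modulus is not altered by the side conditions of {poly %/ _}. *)
Notation polymod L m := {poly %/ @lmod _ L m}.

Definition linmon (F : finFieldType) (L : fieldExtType F) (m i : nat) :
    polymod L m :=
  in_qpoly (lmod L m) 'X^(#|F| ^ i).

Definition linpolys (F : finFieldType) (L : fieldExtType F) (m : nat) :
    {vspace polymod L m} :=
  <<[seq linmon L m i | i <- iota 0 m]>>%VS.

Definition lincomp (F : finFieldType) (L : fieldExtType F) (m : nat)
    (f g : polymod L m) : polymod L m :=
  in_qpoly (lmod L m) ((f : {poly L}) \Po (g : {poly L})).

Definition linid (F : finFieldType) (L : fieldExtType F) (m : nat) :
    polymod L m :=
  in_qpoly (lmod L m) 'X.

(* The evaluation map x |-> f(x), as an F-linear endomorphism of L; linfun is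
   only meaningful on linear functions, see lineval_linear below. *)
Definition lineval (F : finFieldType) (L : fieldExtType F) (m : nat)
    (f : polymod L m) : 'End(L) :=
  linfun (fun x : L => (f : {poly L}).[x]).

Definition lrank (F : finFieldType) (L : fieldExtType F) (m : nat)
    (f : polymod L m) : nat :=
  \dim (limg (lineval f)).

Definition is_code (F : finFieldType) (L : fieldExtType F) (m : nat)
    (C : {vspace polymod L m}) : Prop :=
  (C <= linpolys L m)%VS /\ C <> 0%VS.

Definition is_min_rank (F : finFieldType) (L : fieldExtType F) (m : nat)
    (C : {vspace polymod L m}) (d : nat) : Prop :=
  (exists f, [/\ f \in C, f != 0 & lrank f = d]) /\
  (forall f, f \in C -> f != 0 -> (d <= lrank f)%N).

Definition is_MRD (F : finFieldType) (L : fieldExtType F) (m : nat)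
    (C : {vspace polymod L m}) : Prop :=
  is_code C /\ is_min_rank C (m - \dim C + 1)%N.

Definition lin_invertible (F : finFieldType) (L : fieldExtType F) (m : nat)
    (g : polymod L m) : Prop :=
  g \in linpolys L m /\
  exists h, [/\ h \in linpolys L m, lincomp g h = linid L m
              & lincomp h g = linid L m].

Definition lin_equivalent (F : finFieldType) (L : fieldExtType F) (m : nat)
    (C1 C2 : {vspace polymod L m}) : Prop :=
  exists g, lin_invertible g /\
    forall f, f \in C1 <-> (exists2 h, h \in C2 & f = lincomp h g).

Definition gabidulin (F : finFieldType) (L : fieldExtType F) (k s m : nat) :
    {vspace polymod L m} :=
  <<[seq linmon L m (s * i) | i <- iota 0 k]>>%VS.

Lemma lmodE (F : finFieldType) (L : fieldExtType F) (m : nat) :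
  (0 < m)%N -> mk_monic (lmod L m) = lmod L m.
Proof.
move=> m_gt0; rewrite /mk_monic /lmod.
have lt1 : (1 < #|F| ^ m)%N.
  by rewrite -{1}(exp1n m) ltn_exp2r // finNzRing_gt1.
have szX : (size (- 'X : {poly L}) < size ('X^(#|F| ^ m) : {poly L}))%N.
  by rewrite size_polyN size_polyX size_polyXn.
rewrite size_polyDl // size_polyXn ltnS (ltnW lt1) /=.
by rewrite monicE lead_coefDl // lead_coefXn eqxx.
Qed.

Lemma linmonE (F : finFieldType) (L : fieldExtType F) (m i : nat) :
  (i < m)%N -> linmon L m i = 'X^(#|F| ^ i) :> {poly L}.
Proof.
move=> lt_im; have m_gt0 : (0 < m)%N by apply: leq_ltn_trans lt_im.
have q_gt1 : (1 < #|F|)%N by rewrite finNzRing_gt1.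
rewrite /linmon in_qpoly_small // lmodE // /lmod size_polyDl.
  by rewrite !size_polyXn ltnS ltn_exp2l.
rewrite size_polyN size_polyX size_polyXn ltnS.
change (1 < #|F| ^ m)%N; by rewrite -{1}(exp1n m) ltn_exp2r.
Qed.

Lemma expr_card_linear (F : finFieldType) (L : fieldExtType F) (i : nat) :
  linear (fun x : L => x ^+ (#|F| ^ i)).
Proof.
move=> a x y /=; have [p p_pr pcharF] := finPcharP F.
have pcharL : p \in [pchar L] by rewrite pchar_lalg.
have qN : [pchar L].-nat (#|F| ^ i)%N.
  rewrite pnatX (card_pprimeChar pcharF) pnatX.
  by rewrite (eq_pnat _ (pcharf_eq pcharL)) pnat_id.
rewrite exprDn_pchar // exprZn; congr (_ *: _ + _).
by elim: i {qN} => [|i IH]; rewrite ?expr1 // expnSr exprM IH expf_card.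
Qed.

Lemma linpolysP (F : finFieldType) (L : fieldExtType F) (m : nat)
    (f : polymod L m) :
  reflect (exists c : 'I_m -> L,
             (f : {poly L}) = \sum_(i < m) c i *: 'X^(#|F| ^ i))
          (f \in linpolys L m).
Proof.
pose X := [tuple linmon L m i | i < m].
have -> : linpolys L m = <<X>>%VS.
  by rewrite /linpolys -val_enum_ord -map_comp.
have XE (i : 'I_m) : X`_i = 'X^(#|F| ^ i) :> {poly L}.
  by rewrite -tnth_nth tnth_mktuple linmonE.
apply: (iffP idP) => [/coord_span ->|[c fE]].
  exists (fun i => coord X i f); rewrite poly_of_qpoly_sum.
  by apply: eq_bigr => i _; rewrite -XE.
suff -> : f = \sum_(i < m) c i *: X`_i.
  by apply: rpred_sum => i _; rewrite rpredZ // memv_span // mem_nth // size_tuple.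
apply: val_inj; rewrite /= fE poly_of_qpoly_sum.
by apply: eq_bigr => i _; rewrite -XE.
Qed.

Lemma lineval_linear (F : finFieldType) (L : fieldExtType F) (m : nat)
    (f : polymod L m) :
  f \in linpolys L m -> linear (fun x : L => (f : {poly L}).[x]).
Proof.
move=> /linpolysP[c ->] a x y; rewrite !horner_sum scaler_sumr -big_split /=.
apply: eq_bigr => i _.
by rewrite !hornerZ !hornerXn expr_card_linear mulrDr scalerAr.
Qed.

Lemma dim_linpolys (F : finFieldType) (L : fieldExtType F) (m : nat) :
  \dim (linpolys L m) = m.
Proof.
pose X := [tuple linmon L m i | i < m].
have -> : linpolys L m = <<X>>%VS by rewrite /linpolys -val_enum_ord -map_comp.
suff /eqP -> : free X by rewrite size_tuple.
have XE (j : 'I_m) : X`_j = 'X^(#|F| ^ j) :> {poly L}.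
  by rewrite -tnth_nth tnth_mktuple linmonE.
apply/freeP => c eq0 i.
have: (\sum_(j < m) c j *: X`_j : polymod L m) = 0 :> {poly L} by rewrite eq0.
rewrite poly_of_qpoly_sum => /polyP/(_ (#|F| ^ i)%N).
rewrite coef0 coef_sum (bigD1 i) //= big1 => [|j ne_ji].
  by rewrite addr0 coefZ XE coefXn eqxx mulr1.
rewrite coefZ XE coefXn eqn_exp2l ?finNzRing_gt1 //.
by rewrite eq_sym (inj_eq val_inj) (negPf ne_ji) mulr0.
Qed.

(* Main.v *)
Require Import Defs.
From HB Require Import structures.
From mathcomp Require Import all_boot all_order all_algebra all_field all_fingroup.
From mathcomp Require Import zify ring.
Import GRing.Theory.
Local Open Scope ring_scope.

Set Implicit Arguments.
Unset Strict Implicit.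
Unset Printing Implicit Defensive.

(** For k = 2 one can compose with an invertible map so that the code becomes
    <x, h>, and subtract a multiple of x from h so that h + y x has a nonzero
    zero for every y <> 0 (Payne's theorem on translation ovals then says that
    h is a monomial).  Let A be the Dickson matrix of h.  The polynomial
    det (A + diag (X^(2^j))) is monic of degree 2^m - 1 and vanishes at every
    nonzero y, so it is X^(2^m - 1) - 1.  Its coefficients are the principal
    minors of A, since each exponent is a sum of distinct powers of 2; hence
    every proper principal minor of A is zero.  A shortest zero-sum sequence of
    indices of nonzero coefficients of h has partial sums that index a minor
    with a single nonzero term, so it has length m, which forces h to have a
    single term a x^(2^i) with i coprime to m.

    For k = m - 2 the annihilator of the code with respect to the pairing
    sum_l phi(e_l) f(e_l), for an F_2-basis (e_l), is a 2-dimensional code to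
    which the same result applies; it is spanned by g and g^(2^s).  If G maps
    (e_l) to the trace-dual basis of (g(e_l)), then expanding f in the basis
    G^(2^j) shows that the coefficients of f at j = 0 and j = s vanish. *)

(** * Binary expansions and determinants with a perturbed diagonal *)

Lemma sum_pow2_inj m : injective (fun B : {set 'I_m} => \sum_(j in B) 2 ^ j)%N.
Proof.
elim: m => [|m IH] A B /=; first by move=> _; apply/setP => -[].
have split_sum (D : {set 'I_m.+1}) :
    (\sum_(j in D) 2 ^ j =
     (ord0 \in D) + (\sum_(j in [set j | lift ord0 j \in D]) 2 ^ j).*2)%N.
  rewrite big_mkcond big_ord_recl /=; congr (_ + _)%N.
  rewrite -mul2n big_distrr /= [RHS]big_mkcond /=; apply: eq_bigr => i _.
  by rewrite inE expnS.
rewrite !split_sum => eqAB.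
have eq0 : (ord0 \in A) = (ord0 \in B).
  by move/(congr1 odd): eqAB; rewrite !oddD !odd_double !addbF !oddb.
have /IH/setP eqS : (\sum_(j in [set j | lift ord0 j \in A]) 2 ^ j =
    \sum_(j in [set j | lift ord0 j \in B]) 2 ^ j)%N.
  by apply: double_inj; move: eqAB; rewrite eq0 => /addnI.
apply/setP => i; case: (unliftP ord0 i) => [j|] -> //.
by have := eqS j; rewrite !inE.
Qed.

Lemma sum_pow2 m : (\sum_(j < m) 2 ^ j = (2 ^ m).-1)%N.
Proof. by have := predn_exp 2 m; rewrite mul1n. Qed.

(** Each row of the Leibniz product contributes either its entry of [A] (rows in [T]) or its
    diagonal monomial. A permutation moving a row outside [T] meets an off-diagonal zero there, so
    the coefficient attached to [T] is the principal minor of [A] on [T]. *)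
Lemma det_add_diag_poly (R : comNzRingType) n (A : 'M[R]_n) (d : 'I_n -> nat) :
  \det (\matrix_(j, k) ((A j k)%:P + (j == k)%:R * 'X^(d j))) =
  \sum_(T : {set 'I_n})
     (\sum_(s : 'S_n | perm_on T s) (-1) ^+ s * \prod_(j in T) A j (s j)) *:
     'X^(\sum_(j in ~: T) d j).
Proof.
rewrite /determinant.
under eq_bigr => s _.
  under eq_bigr => j _ do rewrite mxE.
  rewrite bigA_distr big_distrr /=.
  over.
rewrite exchange_big /=; apply: eq_bigr => T _.
rewrite scaler_suml [RHS]big_mkcond /=; apply: eq_bigr => s _.
case: ifPn => [Ts | /subsetPn[j]].
  rewrite -scalerA -mul_polyC rmorphXn rmorphN1; congr (_ * _).
  rewrite (bigID (mem T)) /= -mul_polyC rmorph_prod expr_sum; congr (_ * _).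
    by apply: eq_bigr => j ->.
  rewrite (eq_bigl (mem (~: T))) => [|j]; last by rewrite /= inE.
  apply: eq_bigr => j; rewrite /= inE => nTj.
  by rewrite (negPf nTj) (out_perm Ts nTj) eqxx mul1r.
rewrite inE => sj nTj; rewrite (bigD1 j) //= (negPf nTj) eq_sym (negPf sj).
by rewrite !mul0r mulr0.
Qed.

(** * Zero-sum sequences of minimal length in a finite abelian group *)

Section ZeroSum.
Variable V : finZmodType.

Definition zero_sum (S : pred V) (t : seq V) : bool :=
  [&& t != [::], all S t & \sum_(x <- t) x == 0].

Lemma exists_min_zero_sum (S : pred V) (t0 : seq V) : zero_sum S t0 ->
  exists2 t, zero_sum S t & forall t', zero_sum S t' -> (size t <= size t')%N.
Proof.
(* Quantifying over tuples of a finite type makes the existence of a given length decidable. *)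
move=> zt0; pose P k := [exists t : k.-tuple V, zero_sum S t].
have exP : exists k, P k by exists (size t0); apply/existsP; exists (in_tuple t0).
case: (ex_minnP exP) => k /existsP[t zt] min_k; exists t => // t' zt'.
by rewrite size_tuple min_k //; apply/existsP; exists (in_tuple t').
Qed.

(** [T] is the set of partial sums of [t], and [s0] sends each partial sum to the next one
    cyclically. By minimality the partial sums are distinct, and the only differences in [S] between
    them are the steps of [t]. This isolates a single nonzero term in a principal minor of a Dickson
    matrix. *)
Lemma zero_sum_unique_perm (S : pred V) (t : seq V) : zero_sum S t ->
  (forall t', zero_sum S t' -> (size t <= size t')%N) ->
  exists (T : {set V}) (s0 : {perm V}),
    [/\ #|T| = size t, perm_on T s0, {in T, forall x, S (s0 x - x)}
      & forall s : {perm V}, perm_on T s -> {in T, forall x, S (s x - x)} -> s = s0].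
Proof.
case/and3P => t_neq0 St /eqP sum_t min_t.
set r := size t; have r_gt0 : (0 < r)%N by rewrite lt0n size_eq0.
pose p l := \sum_(x <- take l t) x.
have p0 : p 0%N = 0 by rewrite /p take0 big_nil.
have pr : p r = 0 by rewrite /p take_size.
have sum_drop a b : (a <= b)%N -> \sum_(x <- drop a (take b t)) x = p b - p a.
  move=> leab; rewrite /p -{2}(cat_take_drop a (take b t)) big_cat /=.
  by rewrite take_takel // addrAC subrr add0r.
have S_sub a b : all S (drop a (take b t)).
  by apply/allP => x /mem_drop/mem_take; apply: (allP St).
have p_inj a b : (a < b)%N -> (b < r)%N -> p a != p b.
  move=> ltab ltbr; apply/eqP => eqp.
  have sz : size (drop a (take b t)) = (b - a)%N.
    by rewrite size_drop size_takel // ltnW.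
  suff /min_t : zero_sum S (drop a (take b t)) by rewrite sz -/r; lia.
  rewrite /zero_sum S_sub sum_drop 1?ltnW // eqp subrr eqxx -size_eq0 sz; lia.
(* An edge between partial sums that is not a step of t would close up a
   shorter zero-sum sequence. *)
have edge a b : (a < r)%N -> (b < r)%N -> S (p b - p a) -> p b = p a.+1.
  move=> ltar ltbr Sab; have [leba|ltab] := leqP b a.
    have /min_t /= : zero_sum S ((p b - p a) :: drop b (take a t)).
      rewrite /zero_sum /= Sab S_sub big_cons sum_drop //.
      by rewrite addrA subrK subrr eqxx.
    rewrite size_drop size_takel ?(ltnW ltar) // -/r => le_r.
    have -> : b = 0%N by lia.
    have -> : a.+1 = r by lia.
    by rewrite p0 pr.
  (* For a < b the loop closes through [p r = p 0]: from b on to r, then from 0 on to a. *)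
  have /min_t /= : zero_sum S ((p b - p a) :: drop b (take r t) ++ drop 0 (take a t)).
    rewrite /zero_sum /= Sab all_cat !S_sub big_cons big_cat /=.
    rewrite !sum_drop ?(ltnW ltbr) //.
    by rewrite pr p0 sub0r subr0 [- p b + _]addrC subrKA subrr eqxx.
  rewrite size_cat drop0 size_drop take_size size_takel ?(ltnW ltar) // -/r => le_r.
  by have -> : b = a.+1 by lia.
pose ps := mkseq p r.
have ps_uniq : uniq ps.
  apply/mkseq_uniqP => a b; rewrite !inE => ltar ltbr eqp.
  case: (ltngtP a b) => // [ltab|ltba].
    by have := p_inj a b ltab ltbr; rewrite eqp eqxx.
  by have := p_inj b a ltba ltar; rewrite eqp eqxx.
have mem_ps x : reflect (exists2 l, (l < r)%N & x = p l) (x \in ps).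
  apply: (iffP mapP) => -[l]; first by rewrite mem_iota; exists l.
  by move=> ltlr ->; exists l; rewrite ?mem_iota.
have nextE l : (l < r)%N -> next ps (p l) = p l.+1.
  move=> ltlr; rewrite next_nth; have -> : p l \in ps by apply/mem_ps; exists l.
  have <- : nth 0 ps l = p l by rewrite nth_mkseq.
  rewrite index_uniq ?size_mkseq //.
  case Eps : ps => [|y p'].
    by move: ltlr; rewrite -(size_mkseq p r) -/ps Eps.
  have [ltl|gel] := ltnP l.+1 r.
    by rewrite -[p l.+1](nth_mkseq y _ ltl) -/ps Eps.
  have -> : y = p 0%N.
    by rewrite -[p 0%N](nth_mkseq y p r_gt0) -/ps Eps.
  have -> : l.+1 = r by lia.
  rewrite nth_default ?p0 ?pr //.
  by rewrite -ltnS -[(size p').+1]/(size (y :: p')) -Eps size_mkseq.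
pose s0 := perm (can_inj (prev_next ps_uniq)).
pose T := [set x in ps].
exists T, s0; split.
- by rewrite cardsE (card_uniqP ps_uniq) size_mkseq.
- apply/subsetP => x; rewrite !inE permE; apply: contraR => nps_x.
  by rewrite next_nth (negPf nps_x).
- move=> x; rewrite inE => /mem_ps[l ltlr ->]; rewrite permE nextE //.
  have := S_sub l l.+1; rewrite -sum_drop // (drop_nth 0) ?size_takel //= => /andP[].
  by rewrite drop_oversize ?size_takel // big_seq1.
- move=> s sT good_s; apply/permP => x; rewrite permE.
  have [Tx|nTx] := boolP (x \in T); last first.
    rewrite (out_perm sT nTx); move: nTx; rewrite inE => nTx.
    by rewrite next_nth (negPf nTx).
  have := good_s x Tx; have Tsx : s x \in T by rewrite (perm_closed _ sT).
  move: Tx Tsx; rewrite !inE => /mem_ps[a ltar ->] /mem_ps[b ltbr ->].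
  by rewrite nextE // => /edge->.
Qed.

End ZeroSum.

(** * Residues modulo n, annihilators and dimension counts *)

Lemma big_nseq_add (V : nmodType) k (x : V) : \sum_(y <- nseq k x) y = x *+ k.
Proof. by rewrite big_nseq iter_addr_0. Qed.

Lemma Zp_mulrn_eq0 n (x : 'I_n.+1) k : (n.+1 %| x * k)%N -> x *+ k = 0.
Proof. by rewrite Zp_mulrn => dvd; apply: val_inj; apply/eqP. Qed.

Lemma coprime_Zp_mulrn_onto n (x y : 'I_n.+1) : coprime x n.+1 ->
  exists2 k, (k < n.+1)%N & y = x *+ k.
Proof.
move=> co_x; have [x0|x_gt0] := posnP x.
  move: co_x; rewrite x0 /coprime gcd0n => /eqP n1; exists 0%N => //.
  by apply: val_inj => /=; have := ltn_ord y; lia.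
have [u v equv _] := egcdnP n.+1 x_gt0.
exists ((u * y) %% n.+1)%N; first by rewrite ltn_mod.
apply: val_inj; rewrite Zp_mulrn /= modnMmr mulnA [(x * u)%N]mulnC equv.
by rewrite (eqP co_x) mulnDl mul1n mulnAC modnMDl modn_small.
Qed.

(** Multiplication by [s] permutes the residues modulo [m]. *)
Lemma sum_coprime_reindex (V : nmodType) m s (P : nat -> V) : coprime s m ->
  (forall j, P (j %% m)%N = P j) -> \sum_(j < m) P j = \sum_(j < m) P (s * j)%N.
Proof.
case: m => [|m] co_s P_per; first by rewrite !big_ord0.
pose h (j : 'I_m.+1) : 'I_m.+1 := inZp (s * j).
have h_inj : injective h.
  move=> i j /(congr1 val) /= /eqP eq_ij; apply: val_inj => /=.
  wlog le_ij : i j eq_ij / (i <= j)%N.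
    case/orP: (leq_total i j) => le_ij Wlog; first exact: Wlog.
    by apply/esym/Wlog; rewrite // eq_sym.
  move: eq_ij; rewrite eq_sym eqn_mod_dvd ?leq_mul2l ?le_ij ?orbT // -mulnBr.
  rewrite Gauss_dvdr 1?coprime_sym // => dvd; have := ltn_ord j.
  have [/eqP|/dvdn_leq/(_ dvd)] := posnP (j - i); last by lia.
  by rewrite subn_eq0 => le_ji _; apply/eqP; rewrite eqn_leq le_ij.
by rewrite (reindex_inj h_inj); apply: eq_bigr => j _; rewrite /= P_per.
Qed.

Lemma exists_two_annihilators (K : fieldType) k n (A : 'M[K]_(k, n)) : (k + 2 <= n)%N ->
  exists r1 r2 : 'rV[K]_n, [/\ r1 *m A^T = 0, r2 *m A^T = 0
    & forall a b, a *: r1 + b *: r2 = 0 -> a = 0 /\ b = 0].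
Proof.
move=> le_kn; set N := kermx A^T; pose B := row_base N.
have rk : (2 <= \rank N)%N.
  by rewrite mxrank_ker mxrank_tr; have := rank_leq_row A; lia.
have BA : B *m A^T = 0 by apply/sub_kermxP; rewrite eq_row_base.
pose i1 := Ordinal (ltnW rk); pose i2 := Ordinal rk.
exists (row i1 B), (row i2 B); split; try by rewrite -row_mul BA row0.
move=> a b; rewrite !rowE !scalemxAl -mulmxDl -[RHS](mul0mx _ B).
move/(row_free_inj (row_base_free _))/rowP => ab0.
have := ab0 i1; have := ab0 i2; rewrite !mxE !eqxx /= !mulr0 !mulr1 add0r addr0.
by move=> -> ->.
Qed.

Lemma leq_dimv_cap (K : fieldType) (vT : vectType K) (U V : {vspace vT}) a b :
  (\dim {:vT} <= \dim U + a -> \dim {:vT} <= \dim V + b ->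
   \dim {:vT} <= \dim (U :&: V) + (a + b))%N.
Proof. by have := dimvS (subvf (U + V)); have := dimv_sum_cap U V; lia. Qed.

Lemma F2_neq0 (a : 'F_2) : a != 0 -> a = 1.
Proof. by move=> a_neq0; apply/eqP; move: a a_neq0; case=> -[|[|]]. Qed.

(** * Frobenius powers in a finite extension of the field with two elements *)

Section BinaryExtension.
Variable L : fieldExtType 'F_2.
Local Notation m := (\dim {:L}).

Lemma card_F2 : #|'F_2| = 2%N.
Proof. by rewrite card_Fp. Qed.

Lemma pchar_ext2 : 2%N \in [pchar L].
Proof. by rewrite pchar_lalg pchar_Fp. Qed.

Lemma exprD_pow2 i (x y : L) : (x + y) ^+ (2 ^ i) = x ^+ (2 ^ i) + y ^+ (2 ^ i).
Proof. by rewrite exprDn_pchar // pnatX pnatE // pchar_ext2. Qed.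

Lemma expr0_pow2 i : (0 : L) ^+ (2 ^ i) = 0.
Proof. by rewrite expr0n expn_eq0. Qed.

Lemma expr_sum_pow2 (I : Type) (r : seq I) (P : pred I) (x : I -> L) i :
  (\sum_(j <- r | P j) x j) ^+ (2 ^ i) = \sum_(j <- r | P j) x j ^+ (2 ^ i).
Proof. exact: (big_morph _ (exprD_pow2 i) (expr0_pow2 i)). Qed.

Lemma card_ext2 : #|finvect_type L| = (2 ^ m)%N.
Proof.
by rewrite -(card_vspacef (Vector.class (finvect_type L))) card_vspace card_F2.
Qed.

Lemma expr_card_ext2 (x : L) : x ^+ (2 ^ m) = x.
Proof. by have := expf_card (x : finvect_type L); rewrite card_ext2. Qed.

Lemma expr_pow2_mod (x : L) i : x ^+ (2 ^ (i %% m)) = x ^+ (2 ^ i).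
Proof.
rewrite [in RHS](divn_eq i m) expnD exprM; congr (_ ^+ _).
elim: (i %/ m)%N => [|k IH]; first by rewrite mul0n expr1.
by rewrite mulSn expnD exprM expr_card_ext2.
Qed.

Lemma expr_pow2_inj i : injective (fun x : L => x ^+ (2 ^ i)).
Proof.
move=> x y /eqP; rewrite -subr_eq0 => /eqP exy; apply/eqP.
rewrite -subr_eq0; have /eqP := exprD_pow2 i (x - y) y.
rewrite subrK (canRL (subrK _) exy) add0r -[X in X == _]add0r.
by rewrite (inj_eq (addIr _)) eq_sym expf_eq0 => /andP[].
Qed.

(** The enumeration goes through the finite type [finvect_type L]; as a sequence over [L] it can
    serve as a list of roots. *)
Definition nonzeros : seq L := enum [pred x : finvect_type L | x != 0].

Lemma nonzerosP (x : L) : (x \in nonzeros) = (x != 0).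
Proof. exact: (mem_enum [pred x : finvect_type L | x != 0]). Qed.

Lemma nonzeros_uniq : uniq nonzeros.
Proof. exact: (enum_uniq [pred x : finvect_type L | x != 0]). Qed.

Lemma size_nonzeros : size nonzeros = (2 ^ m).-1.
Proof.
by rewrite -card_ext2 -(cardC1 (0 : finvect_type L)) cardE.
Qed.

(** * Principal minors of the Dickson matrix and Payne's theorem *)

Lemma dickson_minor_eq0 n (c : 'I_n.+1 -> L) (T : {set 'I_n.+1}) :
  m = n.+1 ->
  (forall y, y != 0 -> exists2 x, x != 0 & \sum_i c i * x ^+ (2 ^ i) = y * x) ->
  T != set0 -> T != setT ->
  \sum_(s : 'S_n.+1 | perm_on T s)
     (-1) ^+ s * \prod_(j in T) c (s j - j) ^+ (2 ^ j) = 0.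
Proof.
move=> dimL eig.
pose A := \matrix_(j, k) c (k - j) ^+ (2 ^ j).
pose M := \matrix_(j, k) ((A j k)%:P + (j == k)%:R * 'X^(2 ^ j)) : 'M[{poly L}]_n.+1.
pose w (T : {set 'I_n.+1}) := (\sum_(j in T) 2 ^ j)%N.
pose D (T : {set 'I_n.+1}) := \sum_(s : 'S_n.+1 | perm_on T s)
     (-1) ^+ s * \prod_(j in T) A j (s j).
pose N := (2 ^ n.+1).-1.
have wT : w setT = N by rewrite /N -sum_pow2 /w; apply: eq_bigl => j; rewrite inE.
have w0 : w set0 = 0%N by rewrite /w big_set0.
have w_inj U V : w U = w V -> U = V by move/sum_pow2_inj.
have w_le U : (w U <= N)%N.
  rewrite -wT /w [X in (_ <= X)%N](big_setID U) /= setTI leq_addr //.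
have detM : \det M = \sum_T D T *: 'X^(w (~: T)) by apply: det_add_diag_poly.
have coefM e : (\det M)`_e = \sum_T D T * (e == w (~: T))%:R.
  by rewrite detM coef_sum; apply: eq_bigr => U _; rewrite coefZ coefXn.
have coefMw U : (\det M)`_(w (~: U)) = D U.
  rewrite coefM (bigD1 U) //= eqxx mulr1 big1 ?addr0 // => V neVU.
  by rewrite (inj_eq w_inj) (inj_eq (@setC_inj _)) eq_sym (negPf neVU) mulr0.
have D0 : D set0 = 1.
  rewrite /D (big_pred1 1%g) => [|s]; first by rewrite odd_perm1 big_set0 mulr1.
  apply/idP/eqP => [s0|->]; last exact: perm_on1.
  by apply/permP => j; rewrite perm1 (out_perm s0) ?inE.
have det_root y : y != 0 -> (\det M).[y] = 0.
  move=> y_neq0; have [x x_neq0 eqx] := eig y y_neq0.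
  rewrite -horner_evalE -det_map_mx -det_tr; apply/eqP/det0P.
  (* The powers of the relation h(x) = y x say that this vector is killed by the Dickson matrix plus
     diag(y^(2^j)), since y x + y x = 0 in characteristic 2. *)
  exists (\row_k x ^+ (2 ^ k)).
    apply: contraNneq x_neq0 => /rowP/(_ ord0); rewrite !mxE => /eqP.
    by rewrite expf_eq0 => /andP[].
  apply/rowP => j; rewrite !mxE.
  under eq_bigr => k _.
    rewrite !mxE /= /horner_eval hornerD hornerC hornerM hornerXn.
    rewrite mulrDr.
    over.
  rewrite big_split /= [X in _ + X](bigD1 j) //= eqxx hornerC mul1r.
  rewrite [X in _ + (_ + X)]big1 => [|k]; last first.
    by move=> ne_kj; rewrite eq_sym (negPf ne_kj) horner0 mul0r mulr0.
  rewrite addr0 (reindex_inj (addIr j)) /=.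
  (* The index i + j wraps around modulo n + 1 = m, which is harmless because x^(2^m) = x. *)
  have <- : (\sum_i c i * x ^+ (2 ^ i)) ^+ (2 ^ j) =
     \sum_(i : 'I_n.+1) x ^+ (2 ^ (i + j)%R) * c (i + j - j) ^+ (2 ^ j).
    rewrite expr_sum_pow2; apply: eq_bigr => i _.
    rewrite addrK mulrC exprMn; congr (_ * _).
    by rewrite -exprM -expnD -[LHS]expr_pow2_mod dimL.
  by rewrite eqx exprMn mulrC addrr_pchar2 // pchar_ext2.
have N_gt0 : (0 < N)%N.
  by rewrite /N -ltnS prednK ?expn_gt0 // expnS leq_pmulr ?expn_gt0.
have detE : \det M = 'X^N - 1.
  apply/eqP; rewrite -subr_eq0; apply/eqP.
  (* Both sides are monic of degree [N], so the difference has degree below [N] but vanishes at the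
     [N] nonzero elements of [L]. *)
  apply: (roots_geq_poly_eq0 (rs := nonzeros)); last 1 first.
  - rewrite size_nonzeros dimL -/N; apply/leq_sizeP => e leNe.
    rewrite coefB coefB coefXn coef1 (gtn_eqF (leq_trans N_gt0 leNe)) subr0.
    move: leNe; rewrite leq_eqVlt => /predU1P[<-|ltNe].
      by rewrite eqxx -wT -setC0 coefMw D0 subrr.
    rewrite gtn_eqF // subr0 coefM big1 // => U _.
    by rewrite gtn_eqF ?mulr0 // (leq_ltn_trans (w_le _)).
  - apply/allP => y; rewrite nonzerosP /root => y_neq0.
    rewrite !hornerE det_root // /N -dimL.
    rewrite sub0r oppr_eq0 subr_eq0 -(inj_eq (mulfI y_neq0)) mulr1.
    by rewrite -exprS prednK ?expn_gt0 // expr_card_ext2.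
  - exact: nonzeros_uniq.
move=> T_neq0 T_neqT; have := coefMw T.
have ltwN : (w (~: T) < N)%N.
  by rewrite ltn_neqAle w_le andbT -wT (inj_eq w_inj) -setC0 (inj_eq (@setC_inj _)).
have wgt0 : (0 < w (~: T))%N.
  by rewrite lt0n -w0 (inj_eq w_inj) -setCT (inj_eq (@setC_inj _)).
rewrite detE coefB coefXn coef1 (ltn_eqF ltwN) (gtn_eqF wgt0) subrr => /esym D_T0.
rewrite -[RHS]D_T0; apply: eq_bigr => s _; congr (_ * _).
by apply: eq_bigr => j _; rewrite mxE.
Qed.

Lemma payne_monomial n (c : 'I_n.+1 -> L) :
  m = n.+1 ->
  (forall y, y != 0 -> exists2 x, x != 0 & \sum_i c i * x ^+ (2 ^ i) = y * x) ->
  exists2 i0 : 'I_n.+1, coprime i0 n.+1 & forall i, i != i0 -> c i = 0.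
Proof.
move=> dimL eig; pose S := [pred i | c i != 0].
have [i0 Si0] : exists i0, S i0.
  have [x x_neq0 eqx] := eig 1 (oner_neq0 _); apply/existsP.
  apply: contraNT x_neq0; rewrite negb_exists => /forallP nS.
  rewrite -[x]mul1r -eqx big1 // => i _.
  by have := nS i; rewrite negbK => /eqP->; rewrite mul0r.
have zS k : (0 < k)%N -> (n.+1 %| i0 * k)%N -> zero_sum S (nseq k i0).
  move=> k_gt0 dvdk; rewrite /zero_sum all_nseq Si0 orbT big_nseq_add.
  by rewrite Zp_mulrn_eq0 // eqxx -size_eq0 size_nseq -lt0n k_gt0.
have [t zt min_t] := exists_min_zero_sum (zS n.+1 isT (dvdn_mull _ (dvdnn _))).
have [T [s [cardT sT good_s uniq_s]]] := zero_sum_unique_perm zt min_t.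
have t_gt0 : (0 < size t)%N by case/and3P: zt => + _ _; case: (t).
(* Otherwise [T] is a proper nonempty subset, and its vanishing minor has exactly one nonzero term:
   any permutation other than [s] picks a zero coefficient. *)
have size_t : (n < size t)%N.
  rewrite ltnNge; apply/negP => le_tn.
  have := dickson_minor_eq0 (T := T) dimL eig.
  rewrite -card_gt0 cardT t_gt0 => /(_ isT).
  have -> : T != setT.
    by apply: contraTneq le_tn => TT; rewrite -cardT TT cardsT card_ord ltnn.
  move/(_ isT)/eqP; rewrite (bigD1 s) //= [X in _ + X]big1 ?addr0; last first.
    move=> s' /andP[s'T ne_s's].
    apply/eqP; rewrite mulf_eq0 signr_eq0 /=.
    apply: contraR ne_s's => /prodf_neq0 nz.
    apply/eqP/uniq_s => // j Tj; rewrite /S /=.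
    by apply: contraNneq (nz j Tj) => ->; rewrite expr0_pow2.
  rewrite mulf_eq0 signr_eq0 /=; apply/negP.
  by apply/prodf_neq0 => j Tj; apply/expf_neq0/good_s.
(* With d the gcd, (n + 1)/d copies of [i0] already sum to zero, so minimality forces d = 1. *)
have co_i0 : coprime i0 n.+1.
  set d := gcdn i0 n.+1; have dvd_d : (d %| n.+1)%N by rewrite dvdn_gcdr.
  have d_gt0 : (0 < d)%N by rewrite gcdn_gt0 orbT.
  have k_gt0 : (0 < n.+1 %/ d)%N by rewrite divn_gt0 // dvdn_leq.
  have /(zS _ k_gt0)/min_t : (n.+1 %| i0 * (n.+1 %/ d))%N.
    by rewrite muln_divA // mulnC -muln_divA ?dvdn_gcdl // dvdn_mulr.
  rewrite size_nseq /coprime -/d => le_t.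
  have := leq_trans size_t le_t; rewrite leq_divRL // -[X in (_ <= X)%N]muln1.
  by rewrite leq_pmul2l // => le_d1; rewrite eqn_leq le_d1.
exists i0 => // i ne_i; apply/eqP; apply: contraNT ne_i => ci_neq0.
have [k ltk iE] := coprime_Zp_mulrn_onto i co_i0.
have [n0|n_gt0] := posnP n.
  by apply/eqP/val_inj => /=; have := ltn_ord i; have := ltn_ord i0; lia.
(* This sequence has length n + 2 - k, so k <= 1. Here k = 1 means [i = i0], while k = 0 means i =
   0, a zero-sum sequence of length 1. *)
have /min_t /= : zero_sum S (i :: nseq (n.+1 - k) i0).
  rewrite /zero_sum /= ci_neq0 all_nseq Si0 orbT big_cons big_nseq_add iE -mulrnDr.
  by rewrite subnKC 1?ltnW // Zp_mulrn_eq0 ?dvdn_mull ?eqxx.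
rewrite size_nseq => /(leq_trans size_t).
case: k iE ltk => [|[|k]] iE ltk; [|by rewrite iE|lia] => _.
have /min_t /= : zero_sum S [:: i].
  by rewrite /zero_sum /= ci_neq0 big_seq1 iE mulr0n eqxx.
by move=> /(leq_trans size_t); rewrite ltnS leqNgt n_gt0.
Qed.

(** * Endomorphisms as linearized polynomials, via the Moore matrix *)

Lemma linpoly_linear n (c : 'I_n -> L) :
  linear (fun x : L => \sum_i c i * x ^+ (2 ^ i)).
Proof.
move=> a x y; rewrite scaler_sumr -big_split /=; apply: eq_bigr => i _.
by have := expr_card_linear i a x y; rewrite card_F2 => ->; rewrite mulrDr scalerAr.
Qed.

Lemma linear_eq_on_basis n (X : n.-tuple L) (f g : L -> L) :
  basis_of {:L} X -> linear f -> linear g ->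
  (forall l : 'I_n, f X`_l = g X`_l) -> f =1 g.
Proof.
move=> bX f_lin g_lin eq_fg.
pose F : {linear L -> L} := HB.pack f (GRing.isLinear.Build 'F_2 L L _ f f_lin).
pose G : {linear L -> L} := HB.pack g (GRing.isLinear.Build 'F_2 L L _ g g_lin).
move=> x; rewrite -[f]/(F : L -> L) -[g]/(G : L -> L).
rewrite (coord_basis bX (memvf x)) !linear_sum.
by apply: eq_bigr => l _; rewrite !linearZZ; congr (_ *: _); apply: eq_fg.
Qed.

Definition moore n (X : n.-tuple L) : 'M[L]_n :=
  \matrix_(j, l) X`_l ^+ (2 ^ j).

Lemma linpoly_eq0 n (c : 'I_n -> L) : (n <= m)%N ->
  (forall x, \sum_i c i * x ^+ (2 ^ i) = 0) -> forall i, c i = 0.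
Proof.
move=> le_nm c0 i; pose p := \sum_i c i *: 'X^(2 ^ i).
have p0 : p = 0.
  apply: (roots_geq_poly_eq0 (rs := 0 :: nonzeros)).
  - apply/allP => x _; rewrite /root horner_sum; apply/eqP; rewrite -[RHS](c0 x).
    by apply: eq_bigr => j _; rewrite hornerZ hornerXn.
  - by rewrite /= nonzeros_uniq nonzerosP eqxx.
  - rewrite /= size_nonzeros prednK ?expn_gt0 //.
    apply: (leq_trans (size_sum _ _ _)); apply/bigmax_leqP => j _.
    rewrite (leq_trans (size_scale_leq _ _)) // size_polyXn ltn_exp2l //.
    exact: leq_trans (ltn_ord j) le_nm.
have : p`_(2 ^ i) = 0 by rewrite p0 coef0.
rewrite coef_sum (bigD1 i) //= big1 => [|j ne_ji].
  by rewrite addr0 coefZ coefXn eqxx mulr1.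
by rewrite coefZ coefXn eqn_exp2l // eq_sym (inj_eq val_inj) (negPf ne_ji) mulr0.
Qed.

(** A row vector killed by the Moore matrix is a linearized polynomial vanishing on a basis, hence
    everywhere; its degree is too small for that many roots. *)
Lemma moore_unit n (X : n.-tuple L) : basis_of {:L} X -> moore X \in unitmx.
Proof.
move=> bX; have dimL : m = n by rewrite (size_basis bX).
rewrite unitmxE unitfE; apply/det0P => -[v v_neq0 v0].
case/eqP: v_neq0; apply/rowP => i; rewrite [RHS]mxE.
apply: (linpoly_eq0 (c := v 0)) => [|x]; first by rewrite dimL.
apply: (linear_eq_on_basis bX (linpoly_linear (v 0)) (g := fun=> 0)) => [|l].
  by move=> a y z; rewrite scaler0 addr0.
have /rowP/(_ l) := v0; rewrite !mxE => vl; rewrite -[RHS]vl.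
by apply: eq_bigr => j _; rewrite mxE.
Qed.

Lemma end_linpoly n (phi : 'End(L)) : m = n ->
  exists c : 'I_n -> L, forall x, phi x = \sum_i c i * x ^+ (2 ^ i).
Proof.
move=> <-; have bX := vbasisP {:L}; set X := vbasis _ in bX.
pose c := (\row_l phi X`_l) *m invmx (moore X).
exists (c 0) => x.
apply: (linear_eq_on_basis bX (linearP phi) (linpoly_linear (c 0))) => l.
have /rowP/(_ l) := mulmxKV (moore_unit bX) (\row_l phi X`_l).
rewrite [RHS]mxE => /esym phiE; apply: etrans phiE _; rewrite -/c mxE.
by apply: eq_bigr => i _; congr (_ * _); rewrite mxE.
Qed.

Lemma exists_notin (s : seq L) : (size s < 2 ^ m)%N -> exists t, t \notin s.
Proof.
move=> lts; have /existsP[t nst] : [exists t : finvect_type L, t \notin s].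
  apply: contraLR lts; rewrite negb_exists -leqNgt => /forallP all_s.
  rewrite -card_ext2 (leq_trans _ (card_size (s : seq (finvect_type L)))) //.
  by apply/subset_leq_card/subsetP => x _; have := all_s x; rewrite negbK.
by exists t.
Qed.

Lemma uniq_full_mem (s : seq L) : uniq s -> size s = (2 ^ m)%N -> forall t, t \in s.
Proof.
move=> s_uniq size_s t; apply: contraT => nst.
have Us : uniq (t :: s : seq (finvect_type L)) by rewrite /= nst.
have := max_card (mem (t :: s : seq (finvect_type L))).
by rewrite (card_uniqP Us) /= size_s card_ext2 ltnn.
Qed.

(** * Normal form of a two-dimensional MRD pencil *)

(** The hypothesis is the MRD condition in dimension 2: over the field with two elements, a kernel
    of dimension at most 1 has at most one nonzero element. *)
Lemma payne_pencil (f1 f2 : 'End(L)) : (1 < m)%N ->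
  (forall a b x y, x != 0 -> y != 0 -> x != y ->
     a * f1 x + b * f2 x = 0 -> a * f1 y + b * f2 y = 0 -> a = 0 /\ b = 0) ->
  exists (g : 'End(L)) (t u c : L) (s : nat),
    [/\ lker g == 0%VS, c != 0, (0 < s)%N, coprime s m
      & forall x, g x = f1 x - t * f2 x /\ f2 x = u * g x + c * g x ^+ (2 ^ s)].
Proof.
move=> m_gt1 pencil.
have two_points (x : L) : exists2 y, y != 0 & x != y.
  have [|y] := @exists_notin [:: 0; x].
    by apply: (@leq_trans (2 ^ 2)); rewrite ?leq_exp2l.
  by rewrite !inE negb_or eq_sym => /andP[]; exists y; rewrite // eq_sym.
have no_common x : x != 0 -> f1 x = 0 -> f2 x = 0 -> False.
  move=> x_neq0 f1x f2x; have [y y_neq0 ne_xy] := two_points x.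
  (* This combination vanishes at y by construction and at the common zero x. Hence [f1 y = 0], and
     then [f1] alone vanishes at both points. *)
  have [||f2y /eqP] := pencil (f2 y) (- f1 y) x y x_neq0 y_neq0 ne_xy.
  - by rewrite f1x f2x !mulr0 addr0.
  - by rewrite mulNr mulrC subrr.
  rewrite oppr_eq0 => /eqP f1y.
  have [||/eqP] := pencil 1 0 x y x_neq0 y_neq0 ne_xy.
  - by rewrite f1x mulr0 mul0r addr0.
  - by rewrite f1y mulr0 mul0r addr0.
  by rewrite oner_eq0.
(* Since at most 2^m - 1 slopes f1 x / f2 x occur, some f1 - t f2 is injective. *)
have [|t nt] := @exists_notin [seq f1 x / f2 x | x <- nonzeros].
  by rewrite size_map size_nonzeros prednK ?expn_gt0.
pose g := f1 - (amull t \o f2)%VF.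
have gE x : g x = f1 x - t * f2 x.
  by rewrite add_lfunE opp_lfunE comp_lfunE [amull t _]lfunE.
have g_inj : lker g == 0%VS.
  apply/lker0P => x y eq_g; apply/eqP; rewrite -subr_eq0; apply: contraNT nt => xy_neq0.
  set z := x - y in xy_neq0.
  have /eqP : g z = 0 by rewrite linearB /= eq_g subrr.
  rewrite gE subr_eq0 => /eqP f1z; apply/mapP; exists z; first by rewrite nonzerosP.
  have [f2z|f2z] := eqVneq (f2 z) 0.
    by case: (no_common z) => //; rewrite f1z f2z mulr0.
  by rewrite f1z mulfK.
pose h := (f2 \o g^-1)%VF.
have hg x : h (g x) = f2 x by rewrite comp_lfunE lker0_lfunK.
have gV x : g ((g^-1)%VF x) = x by apply: lker0_lfunVK.
have slope_uniq : uniq [seq h x / x | x <- nonzeros].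
  rewrite map_inj_in_uniq ?nonzeros_uniq // => x y; rewrite !nonzerosP => x_neq0 y_neq0.
  rewrite -[x]gV -[y]gV !hg; set x' := (g^-1)%VF x; set y' := (g^-1)%VF y.
  move=> eq_slope.
  have x'_neq0 : x' != 0.
    by apply: contraNneq x_neq0 => x'0; rewrite -[x]gV -/x' x'0 linear0.
  have y'_neq0 : y' != 0.
    by apply: contraNneq y_neq0 => y'0; rewrite -[y]gV -/y' y'0 linear0.
  apply: contraTeq isT => ne_xy.
  have ne_xy' : x' != y' by apply: contraNneq ne_xy => ->.
  pose v := f2 x' / g x'.
  have vx : f2 x' = v * g x' by rewrite divfK // gV.
  have vy : f2 y' = v * g y' by rewrite /v eq_slope divfK // gV.
  (* The combination is [f2 - v g], where v is the common slope at the two points. *)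
  have [||/eqP] := pencil (- v) (1 + v * t) x' y' x'_neq0 y'_neq0 ne_xy'.
  - by rewrite -[RHS](subrr (f2 x')) [X in _ = _ - X]vx gE; ring.
  - by rewrite -[RHS](subrr (f2 y')) [X in _ = _ - X]vy gE; ring.
  by rewrite oppr_eq0 => /eqP ->; rewrite mul0r addr0 => /eqP; rewrite oner_eq0.
(* The slopes of h are pairwise distinct, so they omit exactly one value u. *)
have [|u nu] := @exists_notin [seq h x / x | x <- nonzeros].
  by rewrite size_map size_nonzeros prednK ?expn_gt0.
have slope v : v != u -> exists2 x, x != 0 & h x = v * x.
  move=> ne_vu; have := @uniq_full_mem (u :: [seq h x / x | x <- nonzeros]) _ _ v.
  rewrite /= nu slope_uniq size_map size_nonzeros prednK ?expn_gt0 // => /(_ isT erefl).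
  rewrite inE (negPf ne_vu) => /mapP[x]; rewrite nonzerosP => x_neq0 ->.
  by exists x; rewrite ?divfK.
have dimL : m = m.-1.+1 by rewrite prednK ?adim_gt0.
have [c hE] := end_linpoly (h - amull u) dimL.
have hE' x : h x - u * x = \sum_i c i * x ^+ (2 ^ i).
  by rewrite -hE add_lfunE opp_lfunE [amull u x]lfunE.
have eig y : y != 0 -> exists2 x, x != 0 & \sum_i c i * x ^+ (2 ^ i) = y * x.
  move=> y_neq0; have [|x x_neq0 hx] := slope (y + u).
    by rewrite -subr_eq0 addrK.
  by exists x; rewrite // -hE' hx mulrDl addrK.
have [i0 co_i0 c0] := payne_monomial dimL eig.
(* Adding [m] to the exponent keeps the Frobenius power and makes the positivity of [s]
   immediate. *)
have hM x : h x = u * x + c i0 * x ^+ (2 ^ (i0 + m)).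
  rewrite -expr_pow2_mod modnDr expr_pow2_mod.
  have := hE' x; rewrite (bigD1 i0) //= big1 => [|i /c0->]; last by rewrite mul0r.
  by rewrite addr0 => <-; rewrite addrC subrK.
exists g, t, u, (c i0), (i0 + m)%N; split=> //.
- have [x x_neq0] := eig 1 (oner_neq0 _).
  rewrite mul1r (bigD1 i0) //= big1 => [|i /c0->]; last by rewrite mul0r.
  by apply: contra_eq_neq => ->; rewrite mul0r addr0 eq_sym.
- by rewrite addn_gt0 adim_gt0 orbT.
- by rewrite /coprime gcdnC gcdnDr gcdnC [X in gcdn _ X]dimL.
- by move=> x; rewrite -hM hg.
Qed.

(** * Prescribed values on a basis and trace-dual bases *)

Lemma end_on_basis n (X : n.-tuple L) (r : 'I_n -> L) : basis_of {:L} X ->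
  exists phi : 'End(L), forall l : 'I_n, phi X`_l = r l.
Proof.
move=> bX; have lin : linear (fun x => \sum_l coord X l x *: r l).
  move=> a x y; rewrite scaler_sumr -big_split /=; apply: eq_bigr => l _.
  by rewrite linearP scalerDl scalerA.
pose F : {linear L -> L} := HB.pack (fun x => \sum_l coord X l x *: r l)
  (GRing.isLinear.Build 'F_2 L L _ _ lin).
exists (linfun F) => l; rewrite lfunE /= (bigD1 l) //= big1 => [|j ne_jl].
  by rewrite coord_free ?(basis_free bX) // eqxx scale1r addr0.
by rewrite coord_free ?(basis_free bX) // eq_sym (negPf ne_jl) scale0r.
Qed.

(* [g] maps X to the trace-dual basis of h, i.e. to the first column of the
   inverse of the Moore matrix of h. *)
Lemma exists_dual_basis n (X h : n.-tuple L) : (0 < n)%N ->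
  basis_of {:L} X -> basis_of {:L} h ->
  exists2 g : 'End(L), lker g == 0%VS
    & forall (phi : 'End(L)) x,
      phi x = \sum_(j < n) (\sum_(l < n) phi X`_l * h`_l ^+ (2 ^ j)) * g x ^+ (2 ^ j).
Proof.
move=> n_gt0 bX bh; have dimL : m = n by rewrite (size_basis bX).
have modE (x : L) i : x ^+ (2 ^ (i %% n)) = x ^+ (2 ^ i) by rewrite -dimL expr_pow2_mod.
pose j0 := Ordinal n_gt0; pose b (l : 'I_n) := invmx (moore h) l j0.
have hb j : \sum_(l < n) h`_l ^+ (2 ^ j) * b l = (n %| j)%:R.
  have lt_jn : (j %% n < n)%N by rewrite ltn_mod.
  have /matrixP/(_ (Ordinal lt_jn) j0) := mulmxV (moore_unit bh).
  rewrite mxE [in RHS]mxE -[_ == j0]/(j %% n == 0)%N => <-.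
  by apply: eq_bigr => l _; rewrite mxE /= modE.
have [g gE] := end_on_basis b bX.
(* The 2^i-th power of [hb] at j + (n - i) gives the sum of h_l^(2^j) b_l^(2^i), so the powers of
   the first column supply the whole inverse matrix. *)
have dual : (moore h)^T *m (\matrix_(j, l) b l ^+ (2 ^ j)) = 1%:M.
  apply: (can_inj trmxK); rewrite trmx_mul trmxK trmx1; apply: mulmx1C.
  apply/matrixP => j i; rewrite [RHS]mxE [LHS]mxE.
  have -> : (j == i)%:R = ((n %| j + (n - i))%:R : L) ^+ (2 ^ i).
    have -> : (n %| j + (n - i))%N = (j == i).
      apply/idP/eqP => [|->]; last by rewrite subnKC ?dvdnn // ltnW.
      have lt_in := ltn_ord i; have lt_jn := ltn_ord j; move/dvdnP => [q Eq].
      by apply/val_inj => /=; case: q Eq => [|[|q]]; rewrite ?mulSn; lia.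
    by case: eqP; rewrite ?expr1n ?expr0_pow2.
  rewrite -hb expr_sum_pow2; apply: eq_bigr => l _.
  rewrite !mxE exprMn -exprM -expnD -addnA subnK 1?ltnW //; congr (_ * _).
  by rewrite -[RHS]modE modnDr modE.
have gP (phi : 'End(L)) x :
  phi x = \sum_(j < n) (\sum_(l < n) phi X`_l * h`_l ^+ (2 ^ j)) * g x ^+ (2 ^ j).
  pose p := (\row_l phi X`_l) *m (moore h)^T.
  have pE j : p 0 j = \sum_(l < n) phi X`_l * h`_l ^+ (2 ^ j).
    by rewrite mxE; apply: eq_bigr => l _; rewrite !mxE.
  under eq_bigr => j _ do rewrite -pE.
  apply: (linear_eq_on_basis bX (linearP phi)
    (g := fun x => \sum_(j < n) p 0 j * g x ^+ (2 ^ j))).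
    by move=> a y z; rewrite linearP; apply: (linpoly_linear (p 0)).
  move=> l; have : (p *m (\matrix_(j, l) b l ^+ (2 ^ j))) 0 l = phi X`_l.
    by rewrite -mulmxA dual mulmx1 mxE.
  move/esym=> E; apply: etrans E _; rewrite mxE; apply: eq_bigr => j _.
  by congr (_ * _); rewrite mxE gE.
exists g => //; apply/eqP/vspaceP => x; rewrite memv_ker memv0.
apply/eqP/eqP => [gx0|->]; last by rewrite linear0.
(* Expanding the identity map expresses x through g(x), so g is injective. *)
have := gP \1%VF x; rewrite lfunE /= => ->; rewrite big1 // => j _.
by rewrite gx0 expr0_pow2 mulr0.
Qed.

End BinaryExtension.

(** * Codes of linearized polynomials and their evaluations *)

Section Polymod.
Variables (L : fieldExtType 'F_2) (m : nat).
Hypotheses (m_gt0 : (0 < m)%N) (dimL : \dim {:L} = m).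
Implicit Types (f g : polymod L m) (C : {vspace polymod L m}).
Local Notation ev f x := (f : {poly L}).[x].

Lemma size_lmod : size (mk_monic (lmod L m)) = (2 ^ m).+1.
Proof.
rewrite lmodE // /lmod card_F2 size_polyDl size_polyXn //.
by rewrite size_polyN size_polyX ltnS (@leq_exp2l 2 1).
Qed.

Lemma horner_lmod (x : L) : (lmod L m).[x] = 0.
Proof. by rewrite /lmod card_F2 !hornerE -dimL expr_card_ext2 subrr. Qed.

(** The modulus vanishes on all of [L], so reduction preserves values. *)
Lemma in_qpolyE (p : {poly L}) x : ev (in_qpoly (lmod L m) p) x = p.[x].
Proof.
have monh := monic_mk_monic (lmod L m).
rewrite [in RHS](Pdiv.RingMonic.rdivp_eq monh p) /= hornerD hornerM.
by rewrite [in X in _ = _ * X + _]lmodE // horner_lmod mulr0 add0r.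
Qed.

Lemma linmon_eval i x : ev (linmon L m i) x = x ^+ (2 ^ i).
Proof. by rewrite in_qpolyE hornerXn card_F2. Qed.

Lemma lincomp_eval f g x : ev (lincomp f g) x = ev f (ev g x).
Proof. by rewrite in_qpolyE horner_comp. Qed.

Lemma linid_eval x : ev (linid L m) x = x.
Proof. by rewrite in_qpolyE hornerX. Qed.

(** Representatives have degree below 2^m, and [L] has 2^m points. *)
Lemma polymod_ext f g : (forall x, ev f x = ev g x) -> f = g.
Proof.
move=> eq_fg; apply: val_inj => /=; apply/eqP; rewrite -subr_eq0; apply/eqP.
apply: (roots_geq_poly_eq0 (rs := 0 :: nonzeros L)).
- by apply/allP => x _; rewrite /root !hornerE eq_fg subrr.
- by rewrite /= nonzeros_uniq nonzerosP eqxx.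
- rewrite /= size_nonzeros dimL prednK ?expn_gt0 //.
  have le_size (p : polymod L m) : (size (p : {poly L}) <= 2 ^ m)%N.
    by rewrite (leq_trans (size_npoly p)) // size_lmod.
  by rewrite (leq_trans (size_polyD _ _)) // geq_max size_polyN !le_size.
Qed.

Lemma lincomb2_eval a b f g x : ev (a *: f + b *: g) x = a * ev f x + b * ev g x.
Proof. by rewrite /= !hornerE. Qed.

Lemma linpolys_of_end (phi : 'End(L)) :
  exists2 f, f \in linpolys L m & forall x, ev f x = phi x.
Proof.
have [c phiE] := end_linpoly phi dimL.
exists (\sum_i c i *: linmon L m i).
  apply: rpred_sum => i _; apply: rpredZ; apply: memv_span.
  by apply: (map_f (linmon L m)); rewrite mem_iota add0n ltn_ord.
move=> x; rewrite phiE poly_of_qpoly_sum horner_sum; apply: eq_bigr => i _.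
by rewrite hornerZ linmon_eval.
Qed.

Lemma linevalE f x : f \in linpolys L m -> lineval f x = ev f x.
Proof.
move=> fL; pose F : {linear L -> L} :=
  HB.pack (fun x : L => ev f x) (GRing.isLinear.Build 'F_2 L L _ _ (lineval_linear fL)).
exact: (lfunE F).
Qed.

(** A nonzero [f] would have nullity at least k and rank at least m - k + 1, against
    rank-nullity. *)
Lemma MRD_vanish C f (U : {vspace L}) : is_MRD C -> f \in C ->
  (\dim C <= \dim U)%N -> (forall x, x \in U -> ev f x = 0) -> f = 0.
Proof.
move=> [[CL _] [_ min_C]] fC leCU fU; apply/eqP; apply: contraT => f_neq0.
have fL : f \in linpolys L m by apply: subvP fC.
have := min_C f fC f_neq0; rewrite /lrank => le_rank.
have leU : (U <= lker (lineval f))%VS.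
  by apply/subvP => x xU; rewrite memv_ker linevalE // fU.
have := leq_add (leq_trans leCU (dimvS leU)) le_rank.
by have := limg_ker_dim (lineval f) fullv; rewrite capfv dimL => ->; lia.
Qed.

Lemma dim_pair (x y : L) : x != 0 -> y != 0 -> x != y -> \dim <<[:: x; y]>> = 2%N.
Proof.
move=> x_neq0 y_neq0 ne_xy; suff /eqP : free [:: x; y] by [].
rewrite free_cons seq1_free y_neq0 andbT span_seq1; apply/vlineP => -[a xE].
have [a0|a_neq0] := eqVneq a 0; first by rewrite xE a0 scale0r eqxx in x_neq0.
by rewrite xE (F2_neq0 a_neq0) scale1r eqxx in ne_xy.
Qed.

(** Only one inclusion has to be checked: the image of the Gabidulin code under right composition
    with [g] is spanned by k elements, so equality follows by dimension. *)
Lemma lin_equivalent_gabidulin C k s (g : 'End(L)) :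
  \dim C = k -> lker g == 0%VS ->
  (forall f, f \in C -> exists y : nat -> L,
     forall x, ev f x = \sum_(i < k) y i * g x ^+ (2 ^ (s * i))) ->
  lin_equivalent C (gabidulin L k s m).
Proof.
move=> dimC g_inj CE.
have [G GL GE] := linpolys_of_end g.
have [H HL HE] := linpolys_of_end (g^-1)%VF.
have rc_lin : linear (fun f => lincomp f G).
  move=> a f f'; apply: polymod_ext => x.
  by rewrite lincomp_eval /= !hornerE !lincomp_eval.
pose RC : {linear polymod L m -> polymod L m} :=
  HB.pack (fun f => lincomp f G) (GRing.isLinear.Build L _ _ _ _ rc_lin).
have RCE f : linfun RC f = lincomp f G by rewrite lfunE.
have CD : C = (linfun RC @: gabidulin L k s m)%VS.
  apply/eqP; rewrite eqEdim; apply/andP; split; last first.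
    by rewrite dimC limg_span (leq_trans (dim_span _)) // !size_map size_iota.
  apply/subvP => f /CE[y fE].
  have -> : f = linfun RC (\sum_(i < k) y i *: linmon L m (s * i)).
    apply: polymod_ext => x; rewrite RCE lincomp_eval GE fE.
    rewrite poly_of_qpoly_sum horner_sum; apply: eq_bigr => i _.
    by rewrite hornerZ linmon_eval.
  apply/memv_img/rpred_sum => i _; apply/rpredZ/memv_span.
  by apply: (map_f (fun i => linmon L m (s * i))); rewrite mem_iota add0n ltn_ord.
exists G; split.
  split=> //; exists H; split=> //; apply: polymod_ext => x.
    by rewrite lincomp_eval linid_eval GE HE lker0_lfunVK.
  by rewrite lincomp_eval linid_eval GE HE lker0_lfunK.
move=> f; rewrite CD; split=> [/memv_imgP[h hG ->]|[h hG ->]].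
  by exists h; rewrite ?RCE.
by rewrite -RCE memv_img.
Qed.

(** * MRD codes of dimension 2 *)

Lemma MRD_dim2 C : is_MRD C -> \dim C = 2%N ->
  exists s : nat, [/\ (0 < s)%N, gcdn s m = 1%N
    & lin_equivalent C (gabidulin L 2 s m)].
Proof.
move=> C_MRD dimC; have [[CL _] _] := C_MRD.
have := vbasisP C; move: (vbasis C); rewrite dimC => X bX.
pose f1 := X`_0; pose f2 := X`_1.
have memC f : f \in C -> exists a b, f = a *: f1 + b *: f2.
  move=> fC; rewrite (coord_basis bX fC) big_ord_recl big_ord1.
  by do 2!eexists.
have [f1C f2C] : f1 \in C /\ f2 \in C.
  by split; rewrite (basis_mem bX) // mem_nth ?size_tuple.
have indep a b : a *: f1 + b *: f2 = 0 -> a = 0 /\ b = 0.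
  move=> ab0; have /freeP freeX := basis_free bX.
  have k0 := freeX (fun i : 'I_2 => if i == ord0 then a else b).
  by split; [apply: (k0 _ ord0) | apply: (k0 _ ord_max)];
     rewrite big_ord_recl big_ord1.
have m_gt1 : (1 < \dim {:L})%N.
  by rewrite dimL -(dim_linpolys L m) (leq_trans _ (dimvS CL)) ?dimC.
have [f1L f2L] : f1 \in linpolys L m /\ f2 \in linpolys L m by split; apply: (subvP CL).
have pencil a b x y : x != 0 -> y != 0 -> x != y ->
     a * lineval f1 x + b * lineval f2 x = 0 ->
     a * lineval f1 y + b * lineval f2 y = 0 -> a = 0 /\ b = 0.
  move=> x_neq0 y_neq0 ne_xy; rewrite !linevalE // => fx fy; apply: indep.
  have abC : a *: f1 + b *: f2 \in C by rewrite rpredD ?rpredZ.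
  apply: (MRD_vanish (U := <<[:: x; y]>>) C_MRD abC); first by rewrite dim_pair ?dimC.
  move=> z zU; rewrite -linevalE ?(subvP CL) //; apply/eqP; rewrite -memv_ker.
  apply: subvP zU; apply/span_subvP => w.
  rewrite !inE memv_ker linevalE ?(subvP CL) // lincomb2_eval.
  by case/orP => /eqP->; rewrite ?fx ?fy.
have [g [t [u [c [s [g_inj _ s_gt0 co_s gE]]]]]] := payne_pencil m_gt1 pencil.
exists s; split=> //; first by apply/eqP; rewrite -dimL.
apply: lin_equivalent_gabidulin dimC g_inj _ => f /memC[a [b ->]].
(* Substitute f1 = g + t f2, then f2 = u g + c g^(2^s), in a f1 + b f2. *)
exists (fun i => if i == 0%N then a + (a * t + b) * u else (a * t + b) * c) => x.
have [gx f2x] := gE x; rewrite !linevalE // in gx f2x.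
rewrite lincomb2_eval big_ord_recl big_ord1 /= muln0 muln1 expn0 expr1.
have -> : ev f1 x = g x + t * ev f2 x by rewrite gx subrK.
by rewrite f2x; ring.
Qed.

(** * MRD codes of codimension 2 *)

(** This is the coordinate dot product with [z]. Its use is that pairing it with an endomorphism psi
    along [X] returns psi(z). *)
Lemma functional_poly n (X : n.-tuple L) (z : L) : exists2 p, p \in linpolys L m
  & forall u, ev p u = (\sum_(l < n) coord X l u * coord X l z)%:A.
Proof.
have lin : linear (fun u : L => (\sum_(l < n) coord X l u * coord X l z)%:A : L).
  move=> a u v; rewrite scalerA -scalerDl mulr_sumr -big_split /=.
  by congr (_ *: _); apply: eq_bigr => l _; rewrite linearP mulrDl mulrA.
pose F : {linear L -> L} := HB.pack
  (fun u : L => (\sum_(l < n) coord X l u * coord X l z)%:A : L)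
  (GRing.isLinear.Build 'F_2 L L _ _ lin).
have [p pL pE] := linpolys_of_end (linfun F).
by exists p => // u; rewrite pE lfunE.
Qed.

(** The MRD property of the annihilator. The functionals dual to x and y pair with [psi] to [psi x]
    and [psi y], both zero, and together with [C] they span all linearized polynomials. So [psi]
    annihilates everything. *)
Lemma MRD_annihilated_pencil C n (X : n.-tuple L) (psi : 'End(L)) (x y : L) :
  basis_of {:L} X -> is_MRD C -> (\dim C + 2 = m)%N ->
  (forall f, f \in C -> \sum_(l < n) psi X`_l * ev f X`_l = 0) ->
  x != 0 -> y != 0 -> x != y -> psi x = 0 -> psi y = 0 -> forall l : 'I_n, psi X`_l = 0.
Proof.
move=> bX C_MRD dimC psiC x_neq0 y_neq0 ne_xy psix psiy l.
have [[CL _] _] := C_MRD.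
have [px pxL pxE] := functional_poly X x.
have [py pyL pyE] := functional_poly X y.
have coordX (i j : 'I_n) : coord X i X`_j = (j == i)%:R.
  by rewrite coord_free ?(basis_free bX).
have dotX z (j : 'I_n) : \sum_(i < n) coord X i X`_j * coord X i z = coord X j z.
  rewrite (bigD1 j) //= coordX eqxx mul1r big1 ?addr0 // => i ne_ij.
  by rewrite coordX eq_sym (negPf ne_ij) mul0r.
have coord_neq0 z : z != 0 -> exists j : 'I_n, coord X j z = 1.
  move=> z_neq0.
  suff /existsP[j /F2_neq0] : [exists j : 'I_n, coord X j z != 0] by exists j.
  apply: contraNT z_neq0; rewrite negb_exists => /forallP z0.
  rewrite (coord_basis bX (memvf z)) big1 // => j _.
  by have := z0 j; rewrite negbK => /eqP->; rewrite scale0r.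
pose D := <<[:: px; py]>>%VS.
have DE f : f \in D -> exists a b, f = a *: px + b *: py.
  rewrite /D span_cons span_seq1 => /memv_addP[u /vlineP[a ->] [v /vlineP[b ->] ->]].
  by exists a, b.
have DL : (D <= linpolys L m)%VS.
  by apply/span_subvP => f; rewrite !inE => /orP[]/eqP->.
have indep a b : a *: px + b *: py = 0 -> a = 0 /\ b = 0.
  move=> ab0.
  have abE j : a * (coord X j x)%:A + b * (coord X j y)%:A = 0 :> L.
    by rewrite -!dotX -pxE -pyE -lincomb2_eval ab0 /= horner0.
  have [j xj] := coord_neq0 x x_neq0.
  have [yj0|/F2_neq0 yj] := eqVneq (coord X j y) 0.
    have := abE j; rewrite xj yj0 scale1r scale0r mulr0 mulr1 addr0 => a0.
    have [i yi] := coord_neq0 y y_neq0.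
    by have := abE i; rewrite yi a0 mul0r add0r scale1r mulr1.
  have := abE j; rewrite xj yj scale1r !mulr1 => /eqP; rewrite addr_eq0 => /eqP aE.
  (* The coordinate j gave a = -b; a coordinate separating x from y now gives b = 0. *)
  have [i] : exists i : 'I_n, coord X i (x - y) = 1.
    by apply: coord_neq0; rewrite subr_eq0.
  rewrite linearB /= => xyi.
  have := abE i; rewrite aE mulNr addrC -mulrBr -scalerBl -opprB xyi.
  by rewrite scaleN1r mulrN1 => /eqP; rewrite oppr_eq0 => /eqP->; rewrite oppr0.
have dimD : \dim D = 2%N.
  suff /eqP : free [tuple px; py] by [].
  apply/freeP => k; rewrite big_ord_recl big_ord1 => /indep[k0 k1] i.
  have [->|->//] : i = ord0 \/ i = lift ord0 ord0; last exact: k0.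
  by case: i => -[|[|//]] lti; [left|right]; apply: val_inj.
have dim_ker p z : p \in linpolys L m ->
    (forall u, ev p u = (\sum_(l < n) coord X l u * coord X l z)%:A) ->
    (m <= \dim (lker (lineval p)) + 1)%N.
  move=> pL pE; rewrite -{1}dimL -(limg_ker_dim (lineval p) fullv) capfv leq_add2l.
  rewrite -[X in (_ <= X)%N](dimv1 L); apply/dimvS/subvP => w /memv_imgP[u _ ->].
  by rewrite linevalE // pE rpredZ ?mem1v.
(* Functions in D depend only on the two functionals dual to x and y, so they
   vanish on a subspace of codimension 2, where no nonzero f in C vanishes. *)
have capCD : (C :&: D)%VS = 0%VS.
  apply/eqP; rewrite -subv0; apply/subvP => f; rewrite memv_cap memv0 => /andP[fC fD].
  have [a [b fE]] := DE f fD.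
  apply/eqP/(MRD_vanish (U := (lker (lineval px) :&: lker (lineval py))%VS) C_MRD fC).
    rewrite -(leq_add2r 2) dimC -[X in (X <= _)%N]dimL.
    apply: (@leq_dimv_cap _ _ _ _ 1 1); rewrite dimL.
      exact: (dim_ker px x pxL pxE).
    exact: (dim_ker py y pyL pyE).
  move=> u; rewrite memv_cap => /andP[px_u py_u].
  have pxu : ev px u = 0.
    rewrite -(linevalE u pxL); apply/eqP; rewrite -memv_ker.
    exact: px_u.
  have pyu : ev py u = 0.
    rewrite -(linevalE u pyL); apply/eqP; rewrite -memv_ker.
    exact: py_u.
  by rewrite fE lincomb2_eval pxu pyu !mulr0 addr0.
have CDL : (C + D)%VS = linpolys L m.
  apply/eqP; rewrite eqEdim subv_add CL DL dim_linpolys.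
  by have := dimv_sum_cap C D; rewrite capCD dimv0 addn0 dimD dimC => ->; rewrite leqnn.
have psiD f : f \in D -> \sum_(l < n) psi X`_l * ev f X`_l = 0.
  have pair z : \sum_(l < n) psi X`_l * (coord X l z)%:A = psi z.
    rewrite [in RHS](coord_basis bX (memvf z)) linear_sum; apply: eq_bigr => i _.
    by rewrite linearZ /= -scalerAr mulr1.
  case/DE => a [b ->].
  transitivity (a * psi x + b * psi y); last by rewrite psix psiy !mulr0 addr0.
  rewrite -!pair !mulr_sumr -big_split; apply: eq_bigr => i _.
  by rewrite lincomb2_eval pxE pyE !dotX /=; ring.
(* Pairing with the map that is 1 at the l-th basis vector and 0 at the others isolates [psi]
   there. *)
have [delta deltaE] := end_on_basis (fun i => (i == l)%:R) bX.
have [p pL pE] := linpolys_of_end delta.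
have : p \in (C + D)%VS by rewrite CDL.
case/memv_addP => u uC [v vD puv].
have : \sum_(i < n) psi X`_i * ev p X`_i = 0.
  transitivity (\sum_(i < n) psi X`_i * ev u X`_i + \sum_(i < n) psi X`_i * ev v X`_i).
    rewrite -big_split.
    by apply: eq_bigr => i _; rewrite puv /= hornerD mulrDr.
  by rewrite psiC // psiD // addr0.
rewrite (bigD1 l) //= big1 => [|i ne_il]; rewrite pE deltaE.
  by rewrite eqxx mulr1 addr0.
by rewrite (negPf ne_il) mulr0.
Qed.

Lemma MRD_codim2 C : is_MRD C -> (\dim C + 2 = m)%N ->
  exists s : nat, [/\ (0 < s)%N, gcdn s m = 1%N
    & lin_equivalent C (gabidulin L (\dim C) s m)].
Proof.
move=> C_MRD dimC; have [[CL _] _] := C_MRD.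
have [X bX] : exists X : m.-tuple L, basis_of {:L} X.
  by have := vbasisP {:L}; move: (vbasis {:L}); rewrite dimL => X; exists X.
(* Two independent annihilators of [C], recorded by their values on [X]. *)
have [r1 [r2 [r1A r2A indep]]] := exists_two_annihilators
  (\matrix_(i < \dim C, l < m) ev (vbasis C)`_i X`_l) (eq_leq dimC).
have annih (r : 'rV[L]_m) (phi : 'End(L)) f :
    r *m (\matrix_(i < \dim C, l < m) ev (vbasis C)`_i X`_l)^T = 0 ->
    (forall l : 'I_m, phi X`_l = r 0 l) -> f \in C ->
    \sum_(l < m) phi X`_l * ev f X`_l = 0.
  move=> rA phiE fC; rewrite (coord_vbasis fC) poly_of_qpoly_sum.
  under eq_bigr => l _ do rewrite horner_sum mulr_sumr.
  rewrite exchange_big big1 //= => i _.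
  have /rowP/(_ i) := rA; rewrite !mxE => rAi.
  apply: etrans (_ : coord (vbasis C) i f * 0 = _); last by rewrite mulr0.
  rewrite -[in RHS]rAi mulr_sumr; apply: eq_bigr => l _.
  by rewrite !mxE phiE hornerZ; ring.
have [phi1 phi1E] := end_on_basis (r1 0) bX.
have [phi2 phi2E] := end_on_basis (r2 0) bX.
have ann1 f := @annih r1 phi1 f r1A phi1E.
have ann2 f := @annih r2 phi2 f r2A phi2E.
have m_gt1 : (1 < \dim {:L})%N by rewrite dimL -dimC addn2.
have pencil a b x y : x != 0 -> y != 0 -> x != y ->
     a * phi1 x + b * phi2 x = 0 -> a * phi1 y + b * phi2 y = 0 -> a = 0 /\ b = 0.
  move=> x_neq0 y_neq0 ne_xy abx aby; apply: indep.
  pose psi : 'End(L) := ((amull a \o phi1) + (amull b \o phi2))%VF.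
  have psiE z : psi z = a * phi1 z + b * phi2 z.
    by rewrite add_lfunE !comp_lfunE [amull a _]lfunE [amull b _]lfunE.
  apply/rowP => l; rewrite !mxE -phi1E -phi2E -psiE.
  apply: (MRD_annihilated_pencil bX C_MRD dimC _ x_neq0 y_neq0 ne_xy); rewrite ?psiE //.
  move=> f fC; transitivity (a * \sum_(l < m) phi1 X`_l * ev f X`_l
                          + b * \sum_(l < m) phi2 X`_l * ev f X`_l).
    by rewrite !mulr_sumr -big_split; apply: eq_bigr => i _; rewrite /= psiE; ring.
  by rewrite ann1 // ann2 // !mulr0 addr0.
have [g [t [u [c [s [g_inj c_neq0 s_gt0 co_s gE]]]]]] := payne_pencil m_gt1 pencil.
rewrite dimL in co_s.
have gX_basis : basis_of {:L} [tuple of map g X].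
  rewrite -(lker0_limgf g_inj); apply: limg_basis_of => //.
  by rewrite (eqP g_inj) capv0.
have gX (l : 'I_m) : [tuple of map g X]`_l = g X`_l.
  by rewrite (nth_map 0) ?size_tuple.
have [G G_inj GE] := exists_dual_basis m_gt0 bX gX_basis.
have frob_lin : linear (fun x : L => x ^+ (2 ^ (s * 2))).
  by have := @expr_card_linear 'F_2 L (s * 2); rewrite card_F2.
pose frob : {linear L -> L} := HB.pack (fun x : L => x ^+ (2 ^ (s * 2)))
  (GRing.isLinear.Build 'F_2 L L _ _ frob_lin).
(* The surviving exponents will be s * 2, s * 3, and so on; absorbing the Frobenius power 2 s into
   the map makes them start at 0. *)
pose g' := (linfun frob \o G)%VF.
have g'E x : g' x = G x ^+ (2 ^ (s * 2)) by rewrite comp_lfunE lfunE.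
exists s; split=> //; first exact/eqP.
have g'_inj : lker g' == 0%VS.
  apply/lker0P => x y; rewrite !g'E => /expr_pow2_inj eqG.
  exact: (lker0P G_inj _ _ eqG).
apply: (lin_equivalent_gabidulin (erefl (\dim C)) g'_inj) => f fC.
have fL := subvP CL f fC.
have modE (y : L) i : y ^+ (2 ^ (i %% m)) = y ^+ (2 ^ i).
  by rewrite -dimL expr_pow2_mod.
pose p j := \sum_(l < m) ev f X`_l * g X`_l ^+ (2 ^ j).
have p_per j : p (j %% m)%N = p j.
  by apply: eq_bigr => l _; rewrite modE.
(* [p 0] is the pairing of [f] with g = phi1 - t phi2. *)
have p0 : p 0%N = 0.
  transitivity (\sum_(l < m) phi1 X`_l * ev f X`_l
                - t * \sum_(l < m) phi2 X`_l * ev f X`_l).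
    rewrite mulr_sumr -sumrB; apply: eq_bigr => l _.
    by rewrite expn0 expr1 (gE _).1; ring.
  by rewrite ann1 // ann2 // mulr0 subr0.
(* [c * p s] is the pairing of [f] with c g^(2^s) = phi2 - u g. *)
have ps : p s = 0.
  apply: (mulfI c_neq0); rewrite mulr0.
  transitivity (\sum_(l < m) phi2 X`_l * ev f X`_l - u * p 0%N); last first.
    by rewrite ann2 // p0 mulr0 subr0.
  rewrite !mulr_sumr -sumrB; apply: eq_bigr => l _.
  by rewrite expn0 expr1 [phi2 _](gE _).2; ring.
exists (fun i => p (s * (i + 2))%N) => x.
have -> : ev f x = \sum_(j < m) p j * G x ^+ (2 ^ j).
  rewrite -(linevalE x fL) (GE (lineval f) x); apply: eq_bigr => j _; congr (_ * _).
  by apply: eq_bigr => l _; rewrite gX linevalE.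
(* Reordering by multiples of [s] moves the two vanishing coefficients to the front. *)
rewrite (sum_coprime_reindex (P := fun j => p j * G x ^+ (2 ^ j)) co_s); last first.
  by move=> j; rewrite p_per modE.
transitivity (\sum_(0 <= j < \dim C + 2) p (s * j)%N * G x ^+ (2 ^ (s * j))).
  by rewrite dimC big_mkord.
rewrite addn2 !big_nat_recl // muln0 p0 mul0r add0r muln1 ps mul0r add0r.
rewrite big_mkord; apply: eq_bigr => i _.
by rewrite g'E -exprM -expnD -mulnDr add2n addn2.
Qed.

End Polymod.

Theorem theorem3p4 (m : nat) (L : fieldExtType 'F_2)
    (C : {vspace polymod L m}) (k : nat) :
  (0 < m)%N ->
  \dim {:L} = m ->
  is_MRD C ->
  \dim C = k ->
  (1 <= k)%N ->
  k = 2%N \/ k = (m - 2)%N ->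
  exists s : nat, [/\ (0 < s)%N, gcdn s m = 1%N
    & lin_equivalent C (gabidulin L k s m)].
Proof.
move=> m_gt0 dimL C_MRD dimC k_gt0 [k2|km].
  by subst k; rewrite k2; apply: MRD_dim2.
(* As k >= 1, the subtraction m - 2 is not truncated and k + 2 = m. *)
by rewrite -dimC; apply: MRD_codim2 => //; rewrite dimC; lia.
Qed.
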